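(* For $n\ge 3$, none of the monomorphisms $\psi_1:A(\mathbf B_n)\to A(\mathbf A_n)$, $\psi_2:A(\tilde{\mathbf A}_{n-1})\to A(\mathbf B_n)$ and $\psi_3:A(\tilde{\mathbf C}_{n-1})\to A(\mathbf B_n)$ induces an injective function on the set of conjugacy classes; that is, for each of these monomorphisms $\psi_i$ there are two elements of its source that are not conjugate in the source but whose images under $\psi_i$ are conjugate in the target.
   Context: $B_n$ is the $n$-strand braid group with standard generators $\sigma_1,\ldots,\sigma_{n-1}$ (relations $\sigma_i\sigma_j=\sigma_j\sigma_i$ for $|i-j|\ge2$, $\sigma_i\sigma_j\sigma_i=\sigma_j\sigma_i\sigma_j$ for $|i-j|=1$). For $P\subset\{1,\ldots,n\}$, a braid in $B_n$ is $P$-pure if its induced permutation fixes every element of $P$; $1$-pure means $\{1\}$-pure. $B_{n,1}\subset B_n$ is the subgroup of $1$-pure braids; it is generated by $\sigma_1^2,\sigma_2,\ldots,\sigma_{n-1}$. $\operatorname{lk}:B_{n,1}\to\mathbb Z$ is the homomorphism with $\operatorname{lk}(\sigma_1^2)=1$ and $\operatorname{lk}(\sigma_i)=0$ for $i\ge2$ (the linking number of the first strand with the other strands). A braid $\alpha$ is $1$-unlinked if it is $1$-pure and $\operatorname{lk}(\alpha)=0$. The Artin groups are identified, via known isomorphisms, with the following subgroups of $B_{n+1}$: $A(\mathbf A_n)=B_{n+1}$; $A(\mathbf B_n)=B_{n+1,1}$; $A(\tilde{\mathbf A}_{n-1})=\{\alpha\in B_{n+1}\mid \alpha \text{ is } 1\text{-unlinked}\}$;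 $A(\tilde{\mathbf C}_{n-1})=\{\alpha\in B_{n+1}\mid\alpha\text{ is }\{1,n+1\}\text{-pure}\}$. Under these identifications, $\psi_1,\psi_2,\psi_3$ are the inclusion maps. *)

(* Defs.v *)
From HB Require Import structures.
From mathcomp Require Import all_boot all_order all_fingroup all_algebra.
From mathcomp Require Import generic_quotient zify.
From mathcomp Require Import mathcomp_extra boolp classical_sets.
Set Implicit Arguments.
Unset Strict Implicit.
Unset Printing Implicit Defensive.

Import GroupScope.

(* A letter (i, true) stands for the generator sigma_(i+1), and (i, false) for
   its inverse: strands and generators are numbered from 0. *)
Definition braid_word (n : nat) : Type := seq ('I_n.-1 * bool).
HB.instance Definition _ n := Choice.on (braid_word n).

Inductive braid_eq (n : nat) : braid_word n -> braid_word n -> Prop :=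
| braid_eq_refl u : braid_eq u u
| braid_eq_sym u v : braid_eq u v -> braid_eq v u
| braid_eq_trans u v w : braid_eq u v -> braid_eq v w -> braid_eq u w
| braid_eq_cat u u' v v' :
    braid_eq u u' -> braid_eq v v' -> braid_eq (u ++ v) (u' ++ v')
| braid_eq_cancel i e : braid_eq [:: (i, e); (i, ~~ e)] [::]
| braid_eq_far (i j : 'I_n.-1) : (i.+1 < j)%N ->
    braid_eq [:: (i, true); (j, true)] [:: (j, true); (i, true)]
| braid_eq_near (i j : 'I_n.-1) : (i.+1 = j)%N ->
    braid_eq [:: (i, true); (j, true); (i, true)]
             [:: (j, true); (i, true); (j, true)].

Definition braid_eqb n : rel (braid_word n) := fun u v => `[< braid_eq u v >].

Fact braid_eqb_refl n : reflexive (@braid_eqb n).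
Proof. by move=> u; apply/asboolP; apply: braid_eq_refl. Qed.

Fact braid_eqb_sym n : symmetric (@braid_eqb n).
Proof. by move=> u v; apply/asboolP/asboolP; apply: braid_eq_sym. Qed.

Fact braid_eqb_trans n : transitive (@braid_eqb n).
Proof.
move=> v u w /asboolP uv /asboolP vw; apply/asboolP.
exact: braid_eq_trans uv vw.
Qed.

Canonical braid_equiv n := EquivRel (@braid_eqb n)
  (@braid_eqb_refl n) (@braid_eqb_sym n) (@braid_eqb_trans n).

(* The braid group on n strands. *)
Definition braid (n : nat) : Type := {eq_quot (@braid_eqb n)}%qT.
HB.instance Definition _ n := Choice.on (braid n).

Definition braid_of n (w : braid_word n) : braid n := (\pi_(braid n) w)%qT.
Definition word_of n (b : braid n) : braid_word n := repr b.

Lemma word_ofK n (b : braid n) : braid_of (word_of b) = b.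
Proof. exact: reprK. Qed.

Lemma braid_ofP n (u v : braid_word n) :
  braid_of u = braid_of v <-> braid_eq u v.
Proof.
split=> [/eqP|uv]; first by rewrite /braid_of eqmodE => /asboolP.
by apply/eqP; rewrite /braid_of eqmodE; apply/asboolP.
Qed.

Lemma braid_ofK n (w : braid_word n) : braid_eq (word_of (braid_of w)) w.
Proof. by apply/braid_ofP; rewrite word_ofK. Qed.

Lemma braid_ind n (P : braid n -> Prop) :
  (forall w, P (braid_of w)) -> forall b, P b.
Proof. by move=> Pw b; rewrite -(word_ofK b). Qed.

Definition word_inv n (w : braid_word n) : braid_word n :=
  rev [seq (a.1, ~~ a.2) | a <- w].

Lemma word_invK n : involutive (@word_inv n).
Proof.
move=> w; rewrite /word_inv map_rev revK -map_comp map_id_in // => -[i e] _ /=.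
by rewrite negbK.
Qed.

Lemma word_inv_cat n (u v : braid_word n) :
  word_inv (u ++ v) = word_inv v ++ word_inv u.
Proof. by rewrite /word_inv map_cat rev_cat. Qed.

Lemma word_mulV n (w : braid_word n) : braid_eq (w ++ word_inv w) [::].
Proof.
elim: w => [|[i e] w IHw]; first exact: braid_eq_refl.
rewrite -[(i, e) :: w]/([:: (i, e)] ++ w) word_inv_cat.
apply: braid_eq_trans (braid_eq_cancel i e).
rewrite -[X in braid_eq _ X]/([:: (i, e)] ++ ([::] ++ [:: (i, ~~ e)])) -catA.
apply: braid_eq_cat; first exact: braid_eq_refl.
by rewrite catA; apply: braid_eq_cat => //; apply: braid_eq_refl.
Qed.

Lemma word_mulVl n (w : braid_word n) : braid_eq (word_inv w ++ w) [::].
Proof. by have := word_mulV (word_inv w); rewrite word_invK. Qed.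

Lemma word_inv_eq n (u v : braid_word n) :
  braid_eq u v -> braid_eq (word_inv u) (word_inv v).
Proof.
move=> uv.
have H1 : braid_eq (word_inv u ++ (v ++ word_inv v)) (word_inv u).
  rewrite -[X in braid_eq _ X]cats0.
  by apply: braid_eq_cat; [apply: braid_eq_refl | apply: word_mulV].
apply: braid_eq_trans (braid_eq_sym H1) _.
rewrite catA -[X in braid_eq _ X]/([::] ++ word_inv v).
apply: braid_eq_cat; last exact: braid_eq_refl.
apply: braid_eq_trans (word_mulVl u).
by apply: braid_eq_cat; [apply: braid_eq_refl | apply: braid_eq_sym].
Qed.

Section BraidGroup.
Variable n : nat.
Implicit Types b c d : braid n.

Definition braid_one : braid n := braid_of [::].
Definition braid_mul b c : braid n := braid_of (word_of b ++ word_of c).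
Definition braid_inv b : braid n := braid_of (word_inv (word_of b)).

Let mulE (u v : braid_word n) :
  braid_mul (braid_of u) (braid_of v) = braid_of (u ++ v).
Proof. by apply/braid_ofP; apply: braid_eq_cat; apply: braid_ofK. Qed.

Let invE (u : braid_word n) : braid_inv (braid_of u) = braid_of (word_inv u).
Proof. by apply/braid_ofP/word_inv_eq/braid_ofK. Qed.

Fact braid_mulA : associative braid_mul.
Proof.
elim/braid_ind=> u; elim/braid_ind=> v; elim/braid_ind=> w.
by rewrite !mulE catA.
Qed.

Fact braid_mul1 : left_id braid_one braid_mul.
Proof. by elim/braid_ind=> u; rewrite mulE. Qed.

Fact braid_1mul : right_id braid_one braid_mul.
Proof. by elim/braid_ind=> u; rewrite mulE cats0. Qed.

Fact braid_mulV : left_inverse braid_one braid_inv braid_mul.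
Proof.
by elim/braid_ind=> u; rewrite invE mulE; apply/braid_ofP/word_mulVl.
Qed.

Fact braid_Vmul : right_inverse braid_one braid_inv braid_mul.
Proof.
by elim/braid_ind=> u; rewrite invE mulE; apply/braid_ofP/word_mulV.
Qed.

HB.instance Definition _ := isGroup.Build (braid n)
  braid_mulA braid_mul1 braid_1mul braid_mulV braid_Vmul.

Lemma braid_of_nil : braid_of [::] = 1 :> braid n.
Proof. by []. Qed.

Lemma braid_of_cat (u v : braid_word n) :
  braid_of (u ++ v) = braid_of u * braid_of v.
Proof. by rewrite -mulE. Qed.

Lemma braid_of_inv (u : braid_word n) :
  braid_of (word_inv u) = (braid_of u)^-1.
Proof. by rewrite -invE. Qed.

End BraidGroup.

Definition sigma n (i : 'I_n.-1) : braid n := braid_of [:: (i, true)].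

Lemma braid_of_letter n (i : 'I_n.-1) e :
  braid_of [:: (i, e)] = if e then sigma i else (sigma i)^-1.
Proof. by case: e => //; rewrite -braid_of_inv. Qed.

Lemma sigma_far n (i j : 'I_n.-1) : (i.+1 < j)%N ->
  sigma i * sigma j = sigma j * sigma i.
Proof.
by move=> ij; rewrite /sigma -!braid_of_cat; apply/braid_ofP/braid_eq_far.
Qed.

Lemma sigma_near n (i j : 'I_n.-1) : (i.+1 = j)%N ->
  sigma i * sigma j * sigma i = sigma j * sigma i * sigma j.
Proof.
by move=> ij; rewrite /sigma -!braid_of_cat; apply/braid_ofP/braid_eq_near.
Qed.

Local Ltac split_eqn := repeat match goal with
  |- context [@eq_op _ ?a ?b] =>
    lazymatch a with
    | context [if _ then _ else _] => fail
    | _ => case: (@eqP _ a b) => ? /=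
    end
  end.

Section Strands.
Variable n : nat.

Fact left_strand_subproof (i : 'I_n.-1) : (i < n)%N.
Proof. by case: i => i /=; lia. Qed.
Fact right_strand_subproof (i : 'I_n.-1) : (i.+1 < n)%N.
Proof. by case: i => i /=; lia. Qed.

Definition left_strand (i : 'I_n.-1) : 'I_n := Ordinal (left_strand_subproof i).
Definition right_strand (i : 'I_n.-1) : 'I_n :=
  Ordinal (right_strand_subproof i).

Definition adj_perm (i : 'I_n.-1) : 'S_n :=
  tperm (left_strand i) (right_strand i).

Definition word_perm (w : braid_word n) : 'S_n := \prod_(a <- w) adj_perm a.1.

(* Products of permutations are composed from left to right, so braid_perm b p
   is the final position of the strand of b that starts at position p. *)
Definition braid_perm (b : braid n) : 'S_n := word_perm (word_of b).

(* The signed number of crossings in w of the strand starting at position p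
   with the other strands; sigma_i is a positive crossing. *)
Fixpoint word_crossings (w : braid_word n) (p : 'I_n) : int :=
  if w is (i, e) :: w' then
    ((if p \in [:: left_strand i; right_strand i] then (-1) ^+ (~~ e) else 0)
       + word_crossings w' (adj_perm i p))%R
  else 0%R.

Definition braid_crossings (b : braid n) (p : 'I_n) : int :=
  word_crossings (word_of b) p.

Lemma word_perm_cat (u v : braid_word n) :
  word_perm (u ++ v) = word_perm u * word_perm v.
Proof. by rewrite /word_perm big_cat. Qed.

Lemma word_perm_cons a (w : braid_word n) :
  word_perm (a :: w) = adj_perm a.1 * word_perm w.
Proof. by rewrite /word_perm big_cons. Qed.

Lemma word_crossings_cat (u v : braid_word n) p :
  (word_crossings (u ++ v) p =
   word_crossings u p + word_crossings v (word_perm u p))%R.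
Proof.
elim: u p => [|[i e] u IHu] p /=.
  by rewrite /word_perm big_nil perm1 GRing.add0r.
by rewrite IHu GRing.addrA word_perm_cons permM.
Qed.

Lemma adj_permE (i : 'I_n.-1) (p : 'I_n) : adj_perm i p =
  (if p == i :> nat then i.+1 else if p == i.+1 :> nat then i : nat else p)
  :> nat.
Proof.
rewrite /adj_perm; case: tpermP => [->|->|/eqP p1 /eqP p2] /=.
- by rewrite eqxx.
- by rewrite eqxx; case: eqP => //; lia.
- by move: p1 p2; rewrite -!val_eqE /= => /negbTE-> /negbTE->.
Qed.

Lemma strand_crossE (i : 'I_n.-1) (p : 'I_n) :
  (p \in [:: left_strand i; right_strand i])
    = (p == i :> nat) || (p == i.+1 :> nat).
Proof. by rewrite !inE -!val_eqE. Qed.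

Lemma word_perm_eq (u v : braid_word n) :
  braid_eq u v -> word_perm u = word_perm v.
Proof.
elim=> {u v} [//|u v _ -> //|u v w _ -> _ -> //|u u' v v' _ Hu _ Hv|i e|
              i j ij|i j ij].
- by rewrite !word_perm_cat Hu Hv.
- by rewrite !word_perm_cons /word_perm big_nil mulg1 tperm2.
- rewrite !word_perm_cons /word_perm big_nil /= !mulg1.
  apply/permP => p; apply: val_inj; rewrite !permM /= !adj_permE.
  by split_eqn; lia.
- rewrite !word_perm_cons /word_perm big_nil /= !mulg1.
  apply/permP => p; apply: val_inj; rewrite !permM /= !adj_permE.
  by split_eqn; lia.
Qed.

Lemma word_crossings_eq (u v : braid_word n) :
  braid_eq u v -> word_crossings u =1 word_crossings v.
Proof.
elim=> {u v} [//|u v _ Huv p|u v w _ Huv _ Hvw p|u u' v v' Eu Hu _ Hv p|i e p|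
              i j ij p|i j ij p].
- by rewrite Huv.
- by rewrite Huv Hvw.
- by rewrite !word_crossings_cat Hu Hv (word_perm_eq Eu).
- rewrite [LHS]/= !strand_crossE !adj_permE.
  by case: e; split_eqn; lia.
- rewrite [LHS]/= [RHS]/= !strand_crossE !adj_permE.
  by split_eqn; lia.
- rewrite [LHS]/= [RHS]/= !strand_crossE !adj_permE.
  by split_eqn; lia.
Qed.

Lemma braid_perm_of (w : braid_word n) : braid_perm (braid_of w) = word_perm w.
Proof. exact/word_perm_eq/braid_ofK. Qed.

Lemma braid_crossings_of (w : braid_word n) :
  braid_crossings (braid_of w) =1 word_crossings w.
Proof. exact/word_crossings_eq/braid_ofK. Qed.

Lemma braid_permM : {morph braid_perm : b c / b * c}.
Proof.
elim/braid_ind=> u; elim/braid_ind=> v.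
by rewrite -braid_of_cat !braid_perm_of word_perm_cat.
Qed.

Lemma braid_perm1 : braid_perm 1 = 1.
Proof. by rewrite -braid_of_nil braid_perm_of /word_perm big_nil. Qed.

HB.instance Definition _ :=
  isUMagmaMorphism.Build (braid n) 'S_n braid_perm (braid_perm1, braid_permM).

Lemma braid_perm_sigma i : braid_perm (sigma i) = adj_perm i.
Proof. by rewrite braid_perm_of word_perm_cons /word_perm big_nil mulg1. Qed.

Lemma braid_crossingsM (b c : braid n) p :
  (braid_crossings (b * c)%g p =
   braid_crossings b p + braid_crossings c (braid_perm b p))%R.
Proof.
elim/braid_ind: b => u; elim/braid_ind: c => v.
by rewrite -braid_of_cat !braid_crossings_of word_crossings_cat braid_perm_of.
Qed.

Definition pure (P : {set 'I_n}) : pred (braid n) :=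
  fun b => [forall p in P, braid_perm b p == p].

Lemma pureP (P : {set 'I_n}) (b : braid n) :
  reflect {in P, forall p, braid_perm b p = p} (b \in pure P).
Proof. by apply: (iffP 'forall_in_eqP). Qed.

Lemma pure_group_closed P : group_closed (pure P).
Proof.
split=> [|b c /pureP Pb /pureP Pc].
  by apply/pureP => p _; rewrite braid_perm1 perm1.
apply/pureP => p Pp; rewrite braid_permM permM Pb //.
by rewrite -[in LHS](Pc p Pp) -permM -braid_permM mulgV braid_perm1 perm1.
Qed.

End Strands.

Section FirstStrand.
Variable n : nat.
Implicit Types b c : braid n.+1.

Definition pure1 : pred (braid n.+1) := pure [set ord0].
Definition pure1_last : pred (braid n.+1) := pure [set ord0; ord_max].

Lemma pure1P b : reflect (braid_perm b ord0 = ord0) (b \in pure1).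
Proof.
apply: (iffP (pureP _ _)) => [|H p /set1P -> //].
by apply; rewrite inE.
Qed.

Lemma pure1_lastP b :
  reflect (braid_perm b ord0 = ord0 /\ braid_perm b ord_max = ord_max)
          (b \in pure1_last).
Proof.
apply: (iffP (pureP _ _)) => [H|[H0 Hm] p /set2P[] -> //].
by split; apply: H; rewrite !inE eqxx ?orbT.
Qed.

Lemma pure1_last_sub b : b \in pure1_last -> b \in pure1.
Proof. by case/pure1_lastP => b0 _; apply/pure1P. Qed.

(* The linking number of the first strand with the other strands: half of its
   signed number of crossings. On 1-pure braids the division by 2 is exact
   (braid_crossings_even), and there lk is the unique homomorphism such that
   sigma_1^2 has value 1 and sigma_2, ..., sigma_n have value 0 (lkM, lk_sigma0,
   lk_sigmaS and lk_unique). *)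
Definition lk b : int := (braid_crossings b ord0 %/ 2)%Z.

Definition unlinked1 : pred (braid n.+1) :=
  fun b => (b \in pure1) && (lk b == 0%R).

Lemma braid_crossings_parity b p :
  exists k : int,
    (braid_crossings b p = (braid_perm b p : nat)%:Z - p%:Z + 2 * k)%R.
Proof.
elim/braid_ind: b => w; rewrite braid_crossings_of braid_perm_of.
elim: w p => [|[i e] w IHw] p.
  by exists 0%R; rewrite /word_perm big_nil perm1 /=; lia.
have [k Hk] := IHw (adj_perm i p).
rewrite [word_crossings _ _]/= Hk word_perm_cons permM strand_crossE /=.
set q := word_perm w _; rewrite adj_permE.
have [pi|pi] := eqVneq (p : nat) (i : nat).
  rewrite /= pi; exists (k + (e : nat)%:Z - 1)%R; case: (e) => /=;
    rewrite ?GRing.expr0 ?GRing.expr1; lia.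
have [pi1|pi1] := eqVneq (p : nat) i.+1.
  by rewrite /= pi1; exists (k + (e : nat)%:Z)%R; case: (e) => /=;
    rewrite ?GRing.expr0 ?GRing.expr1; lia.
by exists k; rewrite /=; lia.
Qed.

Lemma braid_crossings_even b :
  b \in pure1 -> braid_crossings b ord0 = (2 * lk b)%R.
Proof.
move=> /pure1P b0; rewrite /lk.
have [k ->] := braid_crossings_parity b ord0.
by rewrite b0; lia.
Qed.

Lemma lkM : {in pure1 &, forall b c, lk (b * c)%g = (lk b + lk c)%R}.
Proof.
move=> b c Pb Pc; have := braid_crossingsM b c ord0.
rewrite (pure1P b Pb) (braid_crossings_even Pb) (braid_crossings_even Pc).
by rewrite (@braid_crossings_even (b * c)) ?(proj2 (pure_group_closed _)) //;
  [lia | apply/pure1P; rewrite braid_permM permM (pure1P b Pb); apply/pure1P].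
Qed.

Lemma lk1 : lk 1 = 0%R.
Proof. by rewrite /lk -braid_of_nil braid_crossings_of. Qed.

Lemma lkV : {in pure1, forall b, lk b^-1%g = (- lk b)%R}.
Proof.
move=> b Pb; apply/eqP; rewrite -GRing.addr_eq0 GRing.addrC -lkM ?mulgV ?lk1 //.
by apply: (group_closedV (pure_group_closed _)).
Qed.

Lemma pure1_sigma0 (i : 'I_n.+1.-1) : (i = 0 :> nat)%N ->
  sigma i ^+ 2 \in pure1.
Proof.
move=> i0; apply/pure1P; rewrite expgS expg1 braid_permM braid_perm_sigma.
by rewrite permM tpermK.
Qed.

Lemma pure1_sigmaS (i : 'I_n.+1.-1) : (0 < i)%N -> sigma i \in pure1.
Proof.
move=> i0; apply/pure1P; rewrite braid_perm_sigma; apply/val_inj.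
by rewrite /= adj_permE /= ltn_eqF.
Qed.

Lemma lk_sigma0 (i : 'I_n.+1.-1) : (i = 0 :> nat)%N -> lk (sigma i ^+ 2) = 1%R.
Proof.
move=> i0; rewrite /lk expgS expg1 -braid_of_cat braid_crossings_of.
by rewrite [word_crossings _ _]/= !strand_crossE adj_permE /= i0.
Qed.

Lemma lk_sigmaS (i : 'I_n.+1.-1) : (0 < i)%N -> lk (sigma i) = 0%R.
Proof.
move=> i0; rewrite /lk braid_crossings_of [word_crossings _ _]/=.
rewrite strand_crossE /=.
by rewrite ltn_eqF.
Qed.

Lemma unlinked1_sub b : b \in unlinked1 -> b \in pure1.
Proof. by case/andP. Qed.

Lemma unlinked1_group_closed : group_closed unlinked1.
Proof.
have [P1 PF] := pure_group_closed [set ord0 : 'I_n.+1].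
split=> [|b c /andP[Pb /eqP lb] /andP[Pc /eqP lc]].
  by rewrite unfold_in P1 lk1 eqxx.
rewrite unfold_in PF //= lkM // ?lkV // ?lb ?lc //.
exact: (group_closedV (pure_group_closed _)).
Qed.

Fact pure1_ind_subproof (P : braid n.+1 -> Prop) :
    (forall b, P b -> b \in pure1) ->
    P 1 -> (forall b c, P b -> P c -> P (b * c)) -> (forall b, P b -> P b^-1) ->
    (forall i : 'I_n.+1.-1, (i = 0 :> nat)%N -> P (sigma i ^+ 2)) ->
    (forall i : 'I_n.+1.-1, (0 < i)%N -> P (sigma i)) ->
  {in pure1, forall b, P b}.
Proof.
move=> Ppure P1 PM PV Psq Psg.
pose s k : braid n.+1 := oapp (@sigma n.+1) 1 (insub k).
have sE (i : 'I_n.+1.-1) : s i = sigma i by rewrite /s valK.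
have s_far i j : (i.+1 < j < n)%N -> s i * s j = s j * s i.
  case/andP=> ij jn; have iln : (i < n)%N by lia.
  by rewrite (sE (Ordinal jn : 'I_n.+1.-1)) (sE (Ordinal iln : 'I_n.+1.-1));
    apply: sigma_far.
have s_near i : (i.+1 < n)%N -> s i * s i.+1 * s i = s i.+1 * s i * s i.+1.
  move=> jn; have iln : (i < n)%N by lia.
  by rewrite (sE (Ordinal jn : 'I_n.+1.-1)) (sE (Ordinal iln : 'I_n.+1.-1));
    apply: sigma_near.
have Ps i : (0 < i < n)%N -> P (s i).
  by case/andP=> i0 iln; rewrite (sE (Ordinal iln)); apply: Psg.
pose t := fix t k := if k is k'.+1 then t k' * s k' else 1.
have t_far k i : (k < i < n)%N -> t k * s i = s i * t k.
  elim: k => [|k IHk] ki /=; first by rewrite mulg1 mul1g.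
  by rewrite -mulgA s_far ?mulgA ?IHk //; lia.
have t_near k i : (i.+1 < k <= n)%N -> t k * s i = s i.+1 * t k.
  elim: k => [|k IHk] ki //=; have [ik|ki'] := ltnP i.+1 k.
    by rewrite -mulgA -s_far ?mulgA ?IHk //; lia.
  have -> : k = i.+1 by lia.
  rewrite /= -!mulgA [s i * _]mulgA s_near; last by lia.
  by rewrite !mulgA t_far //; lia.
pose c k := t k * s k ^+ 2 * (t k)^-1.
have Pc k : (k < n)%N -> P (c k).
  elim: k => [|k IHk] kn.
    rewrite /c /= mul1g invg1 mulg1 (sE (Ordinal kn)); exact: Psq.
  have -> : c k.+1 = (s k.+1)^-1 * c k * s k.+1.
    have E : s k * s k.+1 ^+ 2 * (s k)^-1 = (s k.+1)^-1 * s k ^+ 2 * s k.+1.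
      apply: (mulgI (s k.+1)); apply: (mulIg (s k)).
      rewrite !expgS !expg0 !mulg1 !mulgA mulgKV mulgV mul1g -s_near //.
      by rewrite -!mulgA; congr (s k * _); rewrite !mulgA s_near.
    rewrite /c /= invgM.
    have tC : t k * s k.+1 = s k.+1 * t k by rewrite t_far //; lia.
    have tCV : t k * (s k.+1)^-1 = (s k.+1)^-1 * t k.
      exact/commuteV.
    have tVC : (t k)^-1 * s k.+1 = s k.+1 * (t k)^-1.
      by apply: commute_sym; apply/commuteV/commute_sym.
    have -> : (s k.+1)^-1 * (t k * s k ^+ 2 * (t k)^-1) * s k.+1
            = t k * ((s k.+1)^-1 * s k ^+ 2 * s k.+1) * (t k)^-1.
      by rewrite !mulgA tCV -!mulgA tVC.
    by rewrite -E !mulgA.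
  apply/PM; last by apply: Ps; lia.
  by apply/PM; [apply/PV/Ps | apply: IHk]; lia.
have step h k i e : P h -> (k <= n)%N -> (i < n)%N ->
    exists h' k', [/\ P h', (k' <= n)%N &
      h * t k * (if e then s i else (s i)^-1) = h' * t k'].
  move=> Ph kn iln.
  have [ik|ik|ik] := ltngtP i k.
  - have [ik'|ki] := ltnP i.+1 k.
      exists (h * (if e then s i.+1 else (s i.+1)^-1)), k; split=> //.
        by apply: PM => //; case: e; [|apply: PV]; apply: Ps; lia.
      rewrite -!mulgA; congr (h * _).
      have tC : t k * s i = s i.+1 * t k by apply: t_near; lia.
      case: e => //; apply: (mulIg (s i)); apply: (mulgI (s i.+1)).
      by rewrite !mulgA mulgV mul1g -!mulgA tC mulVg mulg1.
    have {ki ik} Ek : k = i.+1 by lia.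
    rewrite {k}Ek in kn *.
    case: e; last by exists h, i; split; [|lia|rewrite /= mulgA mulgK].
    exists (h * c i), i; split; [exact/PM/Pc | lia |].
    by rewrite /c expgS expg1 /= !mulgA mulgKV.
  - exists (h * (if e then s i else (s i)^-1)), k; split=> //.
      by apply: PM => //; case: e; [|apply: PV]; apply: Ps; lia.
    have tC : t k * s i = s i * t k by apply: t_far; lia.
    rewrite -!mulgA; congr (h * _).
    by case: e => //; apply: commuteV.
  - rewrite -{k}ik in kn *.
    case: e; first by exists h, i.+1; split=> //=; rewrite mulgA.
    exists (h * (c i)^-1), i.+1; split=> //; first exact/PM/PV/Pc.
    rewrite /c expgS expg1 /= !invgM invgK !mulgA.
    by rewrite !mulgKV.
have Hw w : exists h k, [/\ P h, (k <= n)%N & braid_of w = h * t k].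
  elim/last_ind: w => [|w [i e] [h [k [Ph kn E]]]].
    by exists 1, 0%N; split; rewrite ?mulg1.
  have [h' [k' [Ph' kn' E']]] := step h k i e Ph kn (ltn_ord i).
  exists h', k'; split=> //; rewrite -cats1 braid_of_cat E -E' sE.
  by rewrite braid_of_letter.
have tperm_ord0 k : (k <= n)%N -> braid_perm (t k) ord0 = k :> nat.
  elim: k => [|k IHk] kn; first by rewrite braid_perm1 perm1.
  rewrite /= braid_permM permM (sE (Ordinal kn : 'I_n.+1.-1)) braid_perm_sigma.
  by rewrite adj_permE IHk ?eqxx //; lia.
elim/braid_ind=> w; have [h [k [Ph kn ->]]] := Hw w.
move=> /pure1P; rewrite braid_permM permM (pure1P h (Ppure h Ph)).
by move=> /(congr1 (@nat_of_ord _)); rewrite tperm_ord0 //= => k0;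
  rewrite k0 /= mulg1.
Qed.

Lemma pure1_ind (P : braid n.+1 -> Prop) :
    P 1 -> (forall b c, P b -> P c -> P (b * c)) -> (forall b, P b -> P b^-1) ->
    (forall i : 'I_n.+1.-1, (i = 0 :> nat)%N -> P (sigma i ^+ 2)) ->
    (forall i : 'I_n.+1.-1, (0 < i)%N -> P (sigma i)) ->
  {in pure1, forall b, P b}.
Proof.
move=> P1 PM PV Psq Psg b Pb.
have Gp := pure_group_closed [set ord0 : 'I_n.+1].
have [Mp Vp] := (group_closedM Gp, group_closedV Gp).
suff [] : P b /\ b \in pure1 by [].
apply: (@pure1_ind_subproof (fun c => P c /\ c \in pure1)) Pb => [c []//||
    c d [Pc c1] [Pd d1]|c [Pc c1]|i i0|i i0].
- by split=> //; case: Gp.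
- by split; [apply: PM | apply: Mp].
- by split; [apply: PV | apply: Vp].
- by split; [apply: Psq | apply: pure1_sigma0].
- by split; [apply: Psg | apply: pure1_sigmaS].
Qed.

Lemma lk_unique (f : braid n.+1 -> int) :
    {in pure1 &, forall b c, f (b * c)%g = (f b + f c)%R} ->
    (forall i : 'I_n.+1.-1, (i = 0 :> nat)%N -> f (sigma i ^+ 2)%g = 1%R) ->
    (forall i : 'I_n.+1.-1, (0 < i)%N -> f (sigma i) = 0%R) ->
  {in pure1, f =1 lk}.
Proof.
move=> fM fsq fsg b Pb.
have Gp := pure_group_closed [set ord0 : 'I_n.+1].
have [Mp Vp] := (group_closedM Gp, group_closedV Gp).
have f1 : f 1 = 0%R.
  have := fM 1 1 Gp.1 Gp.1; rewrite mulg1; lia.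
suff [] : b \in pure1 /\ f b = lk b by [].
apply: (@pure1_ind (fun c => c \in pure1 /\ f c = lk c)) Pb => [|
    c d [c1 fc] [d1 fd]|c [c1 fc]|i i0|i i0].
- by rewrite f1 lk1; split=> //; case: Gp.
- by rewrite fM // lkM // fc fd; split=> //; apply: Mp.
- split; first exact: Vp.
  have := fM _ _ c1 (Vp _ c1); rewrite mulgV f1 lkV // fc => /esym/eqP.
  by rewrite GRing.addrC GRing.addr_eq0 => /eqP.
- by rewrite fsq // lk_sigma0 //; split=> //; apply: pure1_sigma0.
- by rewrite fsg // lk_sigmaS //; split=> //; apply: pure1_sigmaS.
Qed.

End FirstStrand.

(* The Artin groups of types A_n and B_n, and of the affine types A~_{n-1} and
   C~_{n-1} (the parameter n is shifted: artin_affA n is A(A~_{n-1})), as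
   subgroups of the braid group on n+1 strands. *)
Definition artinA (n : nat) : Type := braid n.+1.
HB.instance Definition _ n := Group.on (artinA n).

Definition artinB (n : nat) : Type := {b : braid n.+1 | b \in @pure1 n}.
HB.instance Definition _ n := SubChoice.on (artinB n).
HB.instance Definition _ n := SubChoice_isSubGroup.Build (braid n.+1)
  (fun b => b \in @pure1 n) (artinB n) (pure_group_closed [set ord0]).

Definition artin_affA (n : nat) : Type := {b : braid n.+1 | b \in @unlinked1 n}.
HB.instance Definition _ n := SubChoice.on (artin_affA n).
HB.instance Definition _ n := SubChoice_isSubGroup.Build (braid n.+1)
  (fun b => b \in @unlinked1 n) (artin_affA n) (@unlinked1_group_closed n).

Definition artin_affC (n : nat) : Type :=
  {b : braid n.+1 | b \in @pure1_last n}.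
HB.instance Definition _ n := SubChoice.on (artin_affC n).
HB.instance Definition _ n := SubChoice_isSubGroup.Build (braid n.+1)
  (fun b => b \in @pure1_last n) (artin_affC n)
  (pure_group_closed [set ord0; ord_max]).

Section Inclusions.
Variable n : nat.

Definition psi1 (x : artinB n) : artinA n := \val x.
Definition psi2 (x : artin_affA n) : artinB n :=
  Sub (\val x) (unlinked1_sub (valP x)).
Definition psi3 (x : artin_affC n) : artinB n :=
  Sub (\val x) (pure1_last_sub (valP x)).

Fact psi1_monoid_morphism : monoid_morphism psi1.
Proof. by split=> [|x y]; rewrite /psi1 ?val1 ?valM. Qed.
Fact psi2_monoid_morphism : monoid_morphism psi2.
Proof. by split=> [|x y]; apply: val_inj; rewrite ?valM /psi2 !SubK. Qed.
Fact psi3_monoid_morphism : monoid_morphism psi3.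
Proof. by split=> [|x y]; apply: val_inj; rewrite ?valM /psi3 !SubK. Qed.

HB.instance Definition _ := isUMagmaMorphism.Build (artinB n) (artinA n)
  psi1 psi1_monoid_morphism.
HB.instance Definition _ := isUMagmaMorphism.Build (artin_affA n) (artinB n)
  psi2 psi2_monoid_morphism.
HB.instance Definition _ := isUMagmaMorphism.Build (artin_affC n) (artinB n)
  psi3 psi3_monoid_morphism.

Lemma psi1_inj : injective psi1.
Proof. exact: val_inj. Qed.
Lemma psi2_inj : injective psi2.
Proof. by move=> x y /(congr1 val) xy; apply: val_inj. Qed.
Lemma psi3_inj : injective psi3.
Proof. by move=> x y /(congr1 val) xy; apply: val_inj. Qed.

End Inclusions.

Local Open Scope classical_set_scope.

Definition is_conjugate (G : groupType) (x y : G) : Prop :=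
  exists g, y = (x ^ g)%g.

Definition conj_class (G : groupType) (x : G) : set G :=
  [set y | is_conjugate x y].

Definition conj_classes (G : groupType) : set (set G) := range (@conj_class G).
Arguments conj_classes : clear implicits.

(* The function on conjugacy classes induced by a homomorphism f. *)
Definition conj_map (G H : groupType) (f : G -> H) (C : set G) : set H :=
  [set y | exists2 x, C x & is_conjugate (f x) y].

Lemma conj_map_class (G H : groupType) (f : {multiplicative G -> H}) (x : G) :
  conj_map f (conj_class x) = conj_class (f x).
Proof.
have fJ (a g : G) : f (a ^ g)%g = (f a ^ f g)%g.
  by apply: (mulgI (f g)); rewrite -gmulfM -!conjgC gmulfM.
apply/seteqP; split=> y /= => [[_ [g ->] [h ->]]|xy].
  by exists (f g * h)%g; rewrite fJ conjgM.
by exists x => //; exists 1%g; rewrite conjg1.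
Qed.

(* Main.v *)
Require Import Defs.
From HB Require Import structures.
From mathcomp Require Import all_boot all_order all_fingroup all_algebra.
From mathcomp Require Import boolp classical_sets.
From mathcomp Require Import zify.

(** Each monomorphism is an inclusion between subgroups H of K of a braid
group, so it suffices to find two elements of H that some element of K
conjugates into each other, but that no element of H does. In all three cases
the obstruction in H is a count of crossings. Strands, positions and
generators are numbered from 0 here, and N denotes n+1, the number of strands.

For psi1 and psi3 the elements are squares of two consecutive generators, which
are conjugate by the braid relation (sigma_near_conj). If a strand p is fixed
by the permutations of b and g, then b and b ^ g have the same signed number of
crossings on p (braid_crossingsJ). The strand 0 is crossed in sigma_0^2 but not
in sigma_1^2, which settles psi1; the last strand is crossed in
sigma_(N-2)^2 but not in sigma_(N-3)^2, which settles psi3. For N >= 4 the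
braid that conjugates the last two is a product of sigma_(N-3) and sigma_(N-2),
hence keeps the strand 0 in place.

For psi2 the linking number lk is defined on the whole of K, so no invariant of
this kind is available; the obstruction sits in a centraliser. Let
x = sigma_1 ... sigma_(N-2), which permutes the strands other than 0 in a
single cycle of length n and never crosses the strand 0, and let
y = x ^ (sigma_0^2). If also y = x ^ h with lk h = 0, then
c = sigma_0^2 * h^-1 commutes with x and lk c = 1. But for a 1-pure c that
commutes with x, the number of crossings in c of the strand 0 with the strand p
is unchanged when p is moved along the cycle, so it is a constant k, and
2 * lk c = n * k (lk_cent_cycle_braid). For n >= 3 this excludes lk c = 1. The
argument rests on the signed number of crossings of a given pair of strands
(pair_crossings), which is additive in the braid up to a permutation of the
strands. *)

Set Implicit Arguments.
Unset Strict Implicit.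
Unset Printing Implicit Defensive.

Import GroupScope.

(** * Conjugacy classes *)

Section Conjugacy.

Lemma is_conjugate_refl (G : groupType) (x : G) : is_conjugate x x.
Proof. by exists 1; rewrite conjg1. Qed.

Lemma is_conjugate_sym (G : groupType) (x y : G) :
  is_conjugate x y -> is_conjugate y x.
Proof. by case=> g ->; exists g^-1; rewrite conjgK. Qed.

Lemma is_conjugate_trans (G : groupType) (x y z : G) :
  is_conjugate x y -> is_conjugate y z -> is_conjugate x z.
Proof. by case=> g -> [h ->]; exists (g * h); rewrite conjgM. Qed.

Lemma conj_class_eqP (G : groupType) (x y : G) :
  conj_class x = conj_class y <-> is_conjugate x y.
Proof.
split=> [E|xy].
  have : conj_class y y by apply: is_conjugate_refl.
  by rewrite -E.
apply/seteqP; split=> z /= => [xz|yz]; last exact: is_conjugate_trans xy yz.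
exact: is_conjugate_trans (is_conjugate_sym xy) xz.
Qed.

Lemma conj_map_not_inj (G H : groupType) (f : {multiplicative G -> H}) :
  (exists x y, ~ is_conjugate x y /\ is_conjugate (f x) (f y)) ->
  ~ {in conj_classes G &, injective (conj_map f)}.
Proof.
move=> [x [y [nxy fxy]]] inj; apply/nxy/conj_class_eqP/inj.
- by rewrite inE; exists x.
- by rewrite inE; exists y.
- by rewrite !conj_map_class; apply/conj_class_eqP.
Qed.

End Conjugacy.

(** * Crossings of one strand under conjugation *)

Section Crossings.
Variable n : nat.
Implicit Types (b g : braid n) (i j : 'I_n.-1) (p : 'I_n).

(** On the braids that fix the position p, the number of crossings of the
strand p is a homomorphism to a commutative group. *)
Lemma braid_crossingsJ b g p :
  braid_perm b p = p -> braid_perm g p = p ->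
  braid_crossings (b ^ g) p = braid_crossings b p.
Proof.
move=> bp gp; have := congr1 (fun c => braid_crossings c p) (conjgC b g).
rewrite /= (braid_crossingsM b g) (braid_crossingsM g) bp gp.
by rewrite GRing.addrC => /GRing.addrI->.
Qed.

Lemma sigma_near_conj i j : (i.+1 = j)%N ->
  sigma i ^ (sigma j * sigma i) = sigma j.
Proof.
move=> ij; apply: (mulgI (sigma j * sigma i)).
by rewrite -conjgC mulgA sigma_near.
Qed.

Lemma braid_perm_sigma_sq i : braid_perm (sigma i ^+ 2) = 1.
Proof. by rewrite expgS expg1 braid_permM braid_perm_sigma tperm2. Qed.

Lemma braid_crossings_sigma_sq i p :
  braid_crossings (sigma i ^+ 2) p =
  (if (p == i :> nat) || (p == i.+1 :> nat) then 2 else 0)%R.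
Proof.
rewrite expgS expg1 -braid_of_cat braid_crossings_of.
rewrite [word_crossings _ _]/= !strand_crossE adj_permE.
by do 4?case: eqP => ? //=; lia.
Qed.

Lemma sigma_sq_pure (P : {set 'I_n}) i : sigma i ^+ 2 \in pure P.
Proof. by apply/pureP => p _; rewrite braid_perm_sigma_sq perm1. Qed.

End Crossings.

Section FirstStrandConjugates.
Variable n : nat.
Implicit Types b g : braid n.+1.

Lemma pure1J b g : b \in @pure1 n -> g \in @pure1 n -> b ^ g \in @pure1 n.
Proof.
move=> Pb Pg; have cl := pure_group_closed [set (ord0 : 'I_n.+1)].
rewrite conjgE; apply: (group_closedM cl); first exact: (group_closedV cl).
exact: (group_closedM cl).
Qed.

Lemma unlinked1J b g :
  b \in @unlinked1 n -> g \in @pure1 n -> b ^ g \in @unlinked1 n.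
Proof.
case/andP=> b1 /eqP lb g1; apply/andP; split; first exact: pure1J.
rewrite /lk braid_crossingsJ; [exact/eqP | exact/pure1P | exact/pure1P].
Qed.

End FirstStrandConjugates.

(** * Crossings of a pair of strands *)

(* Only comparisons without an inner conditional are decided or split, so that
   conditionals are resolved from the inside out; trying both truth values
   first prunes the inconsistent branches. *)
Local Ltac case_nat_eqs := repeat match goal with
  |- context [@eq_op _ ?a ?b] =>
    lazymatch constr:((a, b)) with
    | context [if _ then _ else _] => fail
    | _ => first [ have -> : (a == b) = true by lia
                 | have -> : (a == b) = false by lia
                 | case: (@eqP _ a b) => ? ]; rewrite /=
    end
  end.

Section PairCrossings.
Variable n : nat.
Implicit Types (b c : braid n) (w : braid_word n) (p q : 'I_n).

(** Counting the crossings of each pair of strands, rather than of one strand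
with all the others, is what tells the contributions of the strands of a cycle
to the linking number apart. *)
Fixpoint word_pair_crossings w p q : int :=
  if w is (i, e) :: w' then
    ((if ((p == i :> nat) && (q == i.+1 :> nat))
         || ((p == i.+1 :> nat) && (q == i :> nat)) then (-1) ^+ (~~ e) else 0)
       + word_pair_crossings w' (adj_perm i p) (adj_perm i q))%R
  else 0%R.

Lemma word_pair_crossings_cat u v p q :
  (word_pair_crossings (u ++ v) p q =
   word_pair_crossings u p q
   + word_pair_crossings v (word_perm u p) (word_perm u q))%R.
Proof.
elim: u p q => [|[i e] u IHu] p q /=.
  by rewrite /word_perm big_nil !perm1 GRing.add0r.
by rewrite IHu GRing.addrA word_perm_cons !permM.
Qed.

Lemma word_pair_crossings_eq u v :
  braid_eq u v -> word_pair_crossings u =2 word_pair_crossings v.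
Proof.
elim=> {u v} [//|u v _ Huv p q|u v w _ Huv _ Hvw p q|
              u u' v v' Eu Hu _ Hv p q|i e p q|i j ij p q|i j ij p q].
- by rewrite Huv.
- by rewrite Huv Hvw.
- by rewrite !word_pair_crossings_cat Hu Hv (word_perm_eq Eu).
- by rewrite [LHS]/= !adj_permE; case: e; case_nat_eqs; lia.
- rewrite [LHS]/= [RHS]/= !adj_permE.
  by move: (nat_of_ord p) (nat_of_ord q) => {}p {}q; case_nat_eqs; lia.
- rewrite [LHS]/= [RHS]/= !adj_permE.
  by move: (nat_of_ord p) (nat_of_ord q) => {}p {}q; case_nat_eqs; lia.
Qed.

Definition pair_crossings b p q : int := word_pair_crossings (word_of b) p q.

Lemma pair_crossings_of w :
  pair_crossings (braid_of w) =2 word_pair_crossings w.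
Proof. exact/word_pair_crossings_eq/braid_ofK. Qed.

Lemma pair_crossings1 p q : pair_crossings 1 p q = 0%R.
Proof. by rewrite -braid_of_nil pair_crossings_of. Qed.

Lemma pair_crossingsM b c p q :
  (pair_crossings (b * c)%g p q =
   pair_crossings b p q + pair_crossings c (braid_perm b p) (braid_perm b q))%R.
Proof.
elim/braid_ind: b => u; elim/braid_ind: c => v.
rewrite -braid_of_cat !pair_crossings_of word_pair_crossings_cat.
by rewrite braid_perm_of.
Qed.

Lemma pair_crossings_diag b p : pair_crossings b p p = 0%R.
Proof.
elim/braid_ind: b => w; rewrite pair_crossings_of.
elim: w p => [|[i e] w IHw] p //=; rewrite IHw.
by case: ifP => //; lia.
Qed.

Lemma sum_pair_crossings b p :
  (\sum_q pair_crossings b p q = braid_crossings b p)%R.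
Proof.
elim/braid_ind: b => w; rewrite braid_crossings_of.
under eq_bigr do rewrite pair_crossings_of.
elim: w p => [|[i e] w IHw] p /=; first by rewrite big1.
rewrite big_split /= -(IHw (adj_perm i p)); congr (_ + _)%R; last first.
  by rewrite [RHS](reindex_inj (@perm_inj _ (adj_perm i))).
(* In the first letter the strand p crosses at most one other strand. *)
rewrite -big_mkcond /= strand_crossE.
have [pi|pi] := eqVneq (p : nat) (i : nat).
  by rewrite (big_pred1 (right_strand i)) // => q; rewrite /= -val_eqE /=; lia.
have [pi1|pi1] := eqVneq (p : nat) i.+1.
  by rewrite (big_pred1 (left_strand i)) // => q; rewrite /= -val_eqE /=; lia.
by rewrite big_pred0.
Qed.

End PairCrossings.

(** * A cycle of the strands other than the first *)

Section Cycle.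
Variable n : nat.

Definition cycle_braid : braid n.+2 :=
  \prod_(1 <= k < n.+1) sigma (inord k : 'I_n.+2.-1).

Lemma cycle_braid_pure1 : cycle_braid \in @pure1 n.+1.
Proof.
rewrite /cycle_braid big_nat_cond.
elim/big_ind: _ => [|b c|k /andP[/andP[k0 kn] _]].
- exact: (pure_group_closed _).1.
- exact: (group_closedM (pure_group_closed _)).
- by apply: pure1_sigmaS; rewrite inordK.
Qed.

(** The strand that starts at position 1 passes all the others and closes the
cycle; every other strand of the cycle moves one step to the left. *)
Lemma cycle_braid_perm (p : 'I_n.+2) : (1 < p)%N ->
  braid_perm cycle_braid p = p.-1 :> nat.
Proof.
move=> p1.
suff H m : (m <= n)%N ->
    braid_perm (\prod_(1 <= k < m.+1) sigma (inord k : 'I_n.+2.-1)) p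
      = (if p <= m.+1 then p.-1 else p)%N :> nat.
  by rewrite H // -ltnS ltn_ord.
elim: m => [|m IHm] mn.
  by rewrite big_geq // braid_perm1 perm1; case: ifP; lia.
rewrite big_nat_recr //= braid_permM permM braid_perm_sigma adj_permE.
rewrite inordK ?IHm; try lia.
by case: (leqP p m.+1) => ?; case_nat_eqs; case: ifP; lia.
Qed.

Lemma cycle_braid_pair0 q : pair_crossings cycle_braid ord0 q = 0%R.
Proof.
(* Purity is carried along: it says that the strand 0 is still at position 0
   when the next factor begins. *)
suff [] : cycle_braid \in @pure1 n.+1
    /\ forall q, pair_crossings cycle_braid ord0 q = 0%R by [].
rewrite /cycle_braid big_nat_cond.
elim/big_ind: _ => [|b c [b1 Xb] [c1 Xc]|k /andP[/andP[k0 kn] _]].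
- by split=> [|r]; [exact: (pure_group_closed _).1 | rewrite pair_crossings1].
- split=> [|r]; first exact: (group_closedM (pure_group_closed _)).
  by rewrite pair_crossingsM (pure1P _ b1) Xb Xc.
- split=> [|r]; first by apply: pure1_sigmaS; rewrite inordK.
  rewrite pair_crossings_of /= inordK //.
  by case: ifP; [lia | rewrite GRing.addr0].
Qed.

Lemma cycle_braid_unlinked1 : cycle_braid \in @unlinked1 n.+1.
Proof.
apply/andP; split; first exact: cycle_braid_pure1.
by rewrite /lk -sum_pair_crossings big1 // => q _; apply: cycle_braid_pair0.
Qed.

(** Counting the crossings of the strands 0 and p in c * x = x * c, where x is
the cycle, shows that their number in c does not change when p is replaced by
its image under x. It is thus a constant k on the n+1 strands of the cycle, and
the strand 0 has (n+1) * k crossings in c, which are twice its linking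
number. *)
Lemma lk_cent_cycle_braid c : c \in @pure1 n.+1 ->
  commute c cycle_braid -> exists k : int, (2 * lk c = n.+1%:Z * k)%R.
Proof.
move=> c1 cx; pose X := pair_crossings c ord0.
have XE p : X (braid_perm cycle_braid p) = X p.
  have := congr1 (fun b => pair_crossings b ord0 p) cx.
  rewrite /= !pair_crossingsM (pure1P _ c1) (pure1P _ cycle_braid_pure1).
  by rewrite !cycle_braid_pair0 /X; lia.
have Xconst m (lt_m : (m.+1 < n.+2)%N) : X (Ordinal lt_m) = X (lift ord0 ord0).
  elim: m lt_m => [|m IHm] lt_m; first by congr X; apply: val_inj.
  rewrite -XE -(IHm (ltnW lt_m)); congr X; apply: val_inj.
  by rewrite /= cycle_braid_perm.
exists (X (lift ord0 ord0)).
rewrite -braid_crossings_even // -sum_pair_crossings big_ord_recl.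
rewrite pair_crossings_diag GRing.add0r.
rewrite (eq_bigr (fun=> X (lift ord0 ord0))) => [|q _]; last first.
  rewrite -(Xconst q (ltn_ord (lift ord0 q))).
  by rewrite /X; congr (pair_crossings c ord0 _); apply: val_inj.
by rewrite GRing.sumr_const card_ord -GRing.mulr_natl; lia.
Qed.

End Cycle.

(** * Conjugacy classes that are merged by the inclusions *)

Lemma psi1_merges n : (2 <= n)%N -> exists x y : artinB n,
  ~ is_conjugate x y /\ is_conjugate (psi1 x) (psi1 y).
Proof.
move=> n2.
pose i : 'I_n.+1.-1 := Ordinal (ltnW n2); pose j : 'I_n.+1.-1 := Ordinal n2.
exists (Sub (sigma i ^+ 2) (sigma_sq_pure _ i)).
exists (Sub (sigma j ^+ 2) (sigma_sq_pure _ j)); split=> [[g]|].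
  move/(congr1 val); rewrite (gmulfJ val) !SubK => E.
  have := congr1 (fun c => braid_crossings c ord0) E.
  rewrite /= braid_crossingsJ ?braid_crossings_sigma_sq //.
    by rewrite braid_perm_sigma_sq perm1.
  exact/pure1P/(valP g).
exists (sigma j * sigma i : braid n.+1).
by rewrite /psi1 !SubK conjXg sigma_near_conj.
Qed.

Lemma psi2_merges n : (3 <= n)%N -> exists x y : artin_affA n,
  ~ is_conjugate x y /\ is_conjugate (psi2 x) (psi2 y).
Proof.
case: n => // n n3.
pose t : braid n.+2 := sigma (ord0 : 'I_n.+2.-1) ^+ 2.
have t1 : t \in @pure1 n.+1 by apply: pure1_sigma0.
have x1 := cycle_braid_unlinked1 n.
exists (Sub (cycle_braid n) x1).
exists (Sub (cycle_braid n ^ t) (unlinked1J x1 t1)); split=> [[g]|]; last first.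
  by exists (Sub t t1 : artinB n.+1); apply: val_inj; rewrite (gmulfJ val) !SubK.
move/(congr1 val); rewrite (gmulfJ val) !SubK; set h := val g => E.
have /andP[h1 /eqP lh] : h \in @unlinked1 n.+1 := valP g.
have hV1 : h^-1 \in @pure1 n.+1.
  exact: (group_closedV (pure_group_closed _)).
have [||k] := @lk_cent_cycle_braid n (t * h^-1).
- exact: (group_closedM (pure_group_closed _)).
- by apply/commute_sym; rewrite /commute conjgC conjgM E conjgK.
rewrite lkM // lkV // lh lk_sigma0 // GRing.oppr0 GRing.addr0 => H.
have [k0|k0] : (k <= 0 \/ 1 <= k)%R by lia.
- by nia.
- by nia.
Qed.

Lemma psi3_merges n : (3 <= n)%N -> exists x y : artin_affC n,
  ~ is_conjugate x y /\ is_conjugate (psi3 x) (psi3 y).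
Proof.
move=> n3; have [lt_i lt_j] : (n.-2 < n)%N /\ (n.-1 < n)%N by lia.
pose i : 'I_n.+1.-1 := Ordinal lt_i; pose j : 'I_n.+1.-1 := Ordinal lt_j.
exists (Sub (sigma i ^+ 2) (sigma_sq_pure _ i)).
exists (Sub (sigma j ^+ 2) (sigma_sq_pure _ j)); split=> [[g]|].
  move/(congr1 val); rewrite (gmulfJ val) !SubK => E.
  have := congr1 (fun c => braid_crossings c ord_max) E.
  have [_ gm] := pure1_lastP _ (valP g).
  rewrite /= braid_crossingsJ ?braid_perm_sigma_sq ?perm1 //.
  by rewrite !braid_crossings_sigma_sq /=; do 2!case: ifP; lia.
(* Here n >= 3 is needed: it makes both generators different from sigma_0. *)
have g1 : sigma j * sigma i \in @pure1 n.
  by apply: (group_closedM (pure_group_closed _)); apply: pure1_sigmaS => /=; lia.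
exists (Sub (sigma j * sigma i) g1 : artinB n); apply: val_inj.
by rewrite (gmulfJ val) !SubK conjXg sigma_near_conj //=; lia.
Qed.

Theorem theorem1p6 (n : nat) (hn : (3 <= n)%N) :
  [/\ ~ {in conj_classes (artinB n) &, injective (conj_map (@psi1 n))},
      ~ {in conj_classes (artin_affA n) &, injective (conj_map (@psi2 n))}
    & ~ {in conj_classes (artin_affC n) &, injective (conj_map (@psi3 n))}]
  /\
  [/\ exists x y : artinB n,
        ~ is_conjugate x y /\ is_conjugate (psi1 x) (psi1 y),
      exists x y : artin_affA n,
        ~ is_conjugate x y /\ is_conjugate (psi2 x) (psi2 y)
    & exists x y : artin_affC n,
        ~ is_conjugate x y /\ is_conjugate (psi3 x) (psi3 y)].
Proof.
have w1 := psi1_merges (ltnW hn).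
have w2 := psi2_merges hn.
have w3 := psi3_merges hn.
by split; split=> //; apply: conj_map_not_inj.
Qed.
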